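(* Assume $n-1\ge p$ and the setting below. For the general shrinkage estimator $$\hat\Theta_G=X-\Sigma^{1/2}HG(\ell)H^\top\Sigma^{-1/2}(X-\bar X),$$ the statistic $$\hat\Delta_G=\sum_{i=1}^p\ell_i\Big\{g_i^2-2(n-1)\frac{g_i}{\ell_i}-2\sum_{k\ne i}\frac{g_i-g_k}{\ell_i-\ell_k}-4\frac{\partial g_i}{\partial\ell_i}\Big\}$$ (with $g_i=g_i(\ell)$) is an unbiased estimator of $np\{R(\Theta,\hat\Theta_G)-R(\Theta,X)\}$, i.e. $E[\hat\Delta_G]=np\{R(\Theta,\hat\Theta_G)-R(\Theta,X)\}$ for all $\Theta$.
   Context: Let $X=(x_1,\dots,x_n)$ be a random $p\times n$ matrix with independent columns $x_i\sim\mathcal N_p(\theta_i,\Sigma)$, $\Sigma$ known positive definite, $\Theta=(\theta_1,\dots,\theta_n)$ unknown. Loss $L(\Theta,\hat\Theta)=\frac1{np}\mathrm{tr}[(\hat\Theta-\Theta)^\top\Sigma^{-1}(\hat\Theta-\Theta)]$, risk $R(\Theta,\hat\Theta)=E[L(\Theta,\hat\Theta)]$. Let $\bar x=n^{-1}\sum_jx_j$, $\bar X=\bar x\,1_n^\top$. Write the spectral decomposition $\Sigma^{-1/2}(X-\bar X)(X-\bar X)^\top\Sigma^{-1/2}=H\mathcal L H^\top$ with $H$ a $p\times p$ orthogonal matrix and $\mathcal L=\mathrm{diag}(\ell_1,\dots,\ell_p)$, $\ell_1\ge\dots\ge\ell_p$ (a.s. distinct and positive), $\ell=(\ell_1,\dots,\ell_p)^\top$.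 Let $G(\ell)=\mathrm{diag}(g_1(\ell),\dots,g_p(\ell))$ where the $g_i$ are differentiable real functions of $\ell$ such that the expectations involved are finite and Stein's identity applies to the entries of $HG H^\top Y$, where $Y=\Sigma^{-1/2}XO_1$ and $O_1$ is an $n\times(n-1)$ matrix with $O_1^\top O_1=I_{n-1}$, $O_1O_1^\top=I_n-n^{-1}1_n1_n^\top$. *)

(* Defs.v *)
From HB Require Import structures.
From mathcomp Require Import all_boot all_order all_algebra.
From mathcomp Require Import all_classical all_reals all_analysis.
Set Implicit Arguments. Unset Strict Implicit. Unset Printing Implicit Defensive.
Import Order.TTheory GRing.Theory Num.Theory.
Import numFieldNormedType.Exports.
Local Open Scope ring_scope.

Definition mxsym (R : realType) (p : nat) (A : 'M[R]_p) : Prop := A^T = A.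

Definition posdef (R : realType) (p : nat) (A : 'M[R]_p) : Prop :=
  mxsym A /\ forall x : 'cV[R]_p, x != 0 -> 0 < (x^T *m A *m x) 0 0.

Definition spectral_dec (R : realType) (p : nat) (W H : 'M[R]_p) (l : 'rV[R]_p)
  : Prop :=
  [/\ H^T *m H = 1%:M, W = H *m diag_mx l *m H^T &
      forall i j : 'I_p, (i <= j)%N -> l 0 j <= l 0 i].

(* X - Xbar, Xbar = xbar 1_n^T = X (n^-1 1_n 1_n^T) *)
Definition centerX (R : realType) (p n : nat) (X : 'M[R]_(p, n)) : 'M[R]_(p, n) :=
  X - X *m const_mx (n%:R^-1).

Definition Gmat (R : realType) (p : nat) (g : 'I_p -> 'rV[R]_p -> R)
  (l : 'rV[R]_p) : 'M[R]_p := diag_mx (\row_i g i l).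

Definition loss (R : realType) (p n : nat) (Sigma : 'M[R]_p)
  (Theta That : 'M[R]_(p, n)) : R :=
  ((n * p)%:R)^-1 * \tr ((That - Theta)^T *m invmx Sigma *m (That - Theta)).

Definition shrink_est (R : realType) (p n : nat) (S12 H : 'M[R]_p)
  (g : 'I_p -> 'rV[R]_p -> R) (l : 'rV[R]_p) (X : 'M[R]_(p, n)) : 'M[R]_(p, n) :=
  X - S12 *m H *m Gmat g l *m H^T *m invmx S12 *m centerX X.

Definition DeltaG (R : realType) (p n : nat) (g : 'I_p -> 'rV[R]_p -> R)
  (l : 'rV[R]_p) : R :=
  \sum_(i < p) l 0 i *
    (g i l ^+ 2 - 2 * (n - 1)%:R * (g i l / l 0 i)
     - 2 * (\sum_(k < p | k != i) (g i l - g k l) / (l 0 i - l 0 k))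
     - 4 * ('D_(delta_mx 0 i) (g i) l)).

Definition shrinkY (R : realType) (p m : nat) (eigvec : 'M[R]_p -> 'M[R]_p)
  (eigval : 'M[R]_p -> 'rV[R]_p) (g : 'I_p -> 'rV[R]_p -> R)
  (Y : 'M[R]_(p, m)) : 'M[R]_(p, m) :=
  eigvec (Y *m Y^T) *m Gmat g (eigval (Y *m Y^T)) *m (eigvec (Y *m Y^T))^T *m Y.

(* Main.v *)
Require Import Defs.
From HB Require Import structures.
From mathcomp Require Import all_boot all_order all_algebra.
From mathcomp Require Import all_classical all_reals all_analysis.
From mathcomp Require Import measurable_realfun ring lra.
Import Order.TTheory GRing.Theory Num.Theory.
Import numFieldNormedType.Exports.
Local Open Scope classical_set_scope.
Local Open Scope ring_scope.

(* Put F(Y) = H G H^T Y. Expanding the loss gives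
     np (loss(Theta_G) - loss(X)) = sum_i l_i g_i^2 - 2 tr((Y - E Y)^T F(Y)),
   and Stein's identity turns the expectation of the trace into that of div F(Y).
   Where the eigenvalues l of Y Y^T are distinct and positive, perturbation theory gives
     div F = sum_i (m g_i + l_i sum_(k <> i) (g_i - g_k)/(l_i - l_k) + 2 l_i dg_i/dl_i),
   with m = n - 1 the number of columns of Y.
   The exceptional set is the zero set of a nonzero polynomial in independent
   Gaussian variables, which is null by Fubini in one variable at a time. *)

Set Implicit Arguments.
Unset Strict Implicit.
Unset Printing Implicit Defensive.

(** * Eigenvalue perturbation *)

(** The maps [eigvec] and [eigval] are an arbitrary choice of spectral decomposition for each
    symmetric matrix, with no continuity or measurability to rely on. Derivatives therefore come
    from H G H^T, which is insensitive to the signs of eigenvectors, and the exceptional set is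
    described through the entries of Y, where measurability is available. On that set the divisions
    in [DeltaG] and the derivative of F may take default values, so the pointwise identity DeltaG =
    np (loss(Theta_G) - loss(X)) + 2 sum_ab ((Y - E Y)_ab F_ab - dF_ab/dY_ab) is proved only almost
    surely; Stein's identity makes the last sum vanish in expectation. *)

Lemma quad_spectral (R : realType) (p : nat) (H : 'M[R]_p) (l : 'rV[R]_p)
    (u : 'rV[R]_p) :
  (u *m (H *m diag_mx l *m H^T) *m u^T) 0 0
  = \sum_c l 0 c * (u *m H) 0 c ^+ 2.
Proof.
have -> : u *m (H *m diag_mx l *m H^T) *m u^T
          = (u *m H) *m diag_mx l *m (u *m H)^T by rewrite trmx_mul !mulmxA.
rewrite mul_mx_diag !mxE; apply: eq_bigr => c _.
by rewrite !mxE; ring.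
Qed.

Lemma norm_row (R : realType) (p : nat) (u : 'rV[R]_p) :
  (u *m u^T) 0 0 = \sum_c u 0 c ^+ 2.
Proof. by rewrite mxE; apply: eq_bigr => c _; rewrite mxE expr2. Qed.

Lemma norm_row_orth (R : realType) (p : nat) (u : 'rV[R]_p) (H : 'M[R]_p) :
  H *m H^T = 1%:M -> \sum_c (u *m H) 0 c ^+ 2 = \sum_c u 0 c ^+ 2.
Proof.
by move=> HH; rewrite -!norm_row trmx_mul mulmxA -(mulmxA u) HH mulmx1.
Qed.

(* Courant-Fischer style: the span of the first i+1 eigenvectors of W' meets
   the span of the eigenvectors of W of index at least i. *)
Lemma weyl_le (R : realType) (p : nat) (W W' H H' : 'M[R]_p) (l l' : 'rV[R]_p) :
  spectral_dec W H l -> spectral_dec W' H' l' ->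
  forall i, l' 0 i <= l 0 i + \sum_a \sum_b `|(W' - W) a b|.
Proof.
move=> [HTH WE ls] [HTH' WE' ls'] i.
have HH := mulmx1C HTH; have HH' := mulmx1C HTH'.
(* If v C = 0, the identity columns give v_c = 0 for c > i, and the columns c < i make v H'^T
   orthogonal to the first i eigenvectors of W. The null column i makes C singular, so such a v <> 0
   exists. *)
pose C : 'M[R]_p := \matrix_(r, c) if (c < i)%N then (H'^T *m H) r c
  else if c == i then 0 else (r == c)%:R.
have : \det C == 0.
  rewrite (expand_det_col _ i) big1 // => r _.
  by rewrite mxE ltnn eqxx mul0r.
move=> /det0P[v v0 vC].
pose u := v *m H'^T; set s := \sum_c v 0 c ^+ 2.
have vE : u *m H' = v by rewrite /u -mulmxA HTH' mulmx1.
have us : \sum_c u 0 c ^+ 2 = s by rewrite -(norm_row_orth u HH') vE.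
have zs : \sum_c (u *m H) 0 c ^+ 2 = s by rewrite norm_row_orth.
have s0 : 0 < s.
  rewrite lt_neqAle sumr_ge0 ?andbT; last by move=> c _; exact: sqr_ge0.
  rewrite eq_sym; apply: contra v0 => /eqP s0.
  apply/eqP/rowP => c; rewrite mxE; apply/eqP; rewrite -sqrf_eq0; apply/eqP.
  by apply: (psumr_eq0P _ s0) => // k _; exact: sqr_ge0.
have vz (c : 'I_p) : (i < c)%N -> v 0 c = 0.
  move=> ic; have /rowP/(_ c) := vC; rewrite !mxE (bigD1 c)//= big1 => [|r rc].
    by rewrite mxE ltnNge (ltnW ic)/= -val_eqE/= gtn_eqF// eqxx mulr1 addr0.
  by rewrite mxE ltnNge (ltnW ic)/= -val_eqE/= gtn_eqF// (negbTE rc) mulr0.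
have zz (c : 'I_p) : (c < i)%N -> (u *m H) 0 c = 0.
  move=> ci; have /rowP/(_ c) := vC; rewrite -mulmxA => E.
  rewrite -[RHS](mxE matrix_key (fun _ _ => 0) (0 : 'I_1) c).
  move: E; rewrite !mxE => E; rewrite -[RHS]E; apply: eq_bigr => r _.
  by rewrite [C _ _]mxE ci.
have q' : l' 0 i * s <= (u *m W' *m u^T) 0 0.
  rewrite WE' quad_spectral vE mulr_sumr; apply: ler_sum => c _.
  have [ic|ci] := ltnP i c; first by rewrite vz// expr0n !mulr0.
  by rewrite ler_wpM2r ?sqr_ge0 ?ls'.
have q : (u *m W *m u^T) 0 0 <= l 0 i * s.
  rewrite WE quad_spectral -zs mulr_sumr; apply: ler_sum => c _.
  have [ci|ic] := ltnP c i; first by rewrite zz// expr0n !mulr0.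
  by rewrite ler_wpM2r ?sqr_ge0 ?ls.
have uu a b : `|u 0 a| * `|u 0 b| <= s.
  have h c : `|u 0 c| ^+ 2 <= s.
    rewrite real_normK ?num_real// -us (bigD1 c)//= lerDl.
    by apply: sumr_ge0 => k _; exact: sqr_ge0.
  have ha := h a; have hb := h b; nra.
have qe : (u *m (W' - W) *m u^T) 0 0 <= (\sum_a \sum_b `|(W' - W) a b|) * s.
  rewrite mxE exchange_big mulr_suml; apply: ler_sum => b _.
  rewrite mxE !mulr_suml; apply: ler_sum => a _; rewrite [u^T _ _]mxE.
  apply: (le_trans (ler_norm _)); rewrite !normrM mulrAC mulrC.
  by apply: ler_wpM2l.
have := qe; rewrite mulmxBr mulmxBl mxE [X in _ + X]mxE => qe'.
rewrite -(ler_pM2r s0) mulrDl.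
lra.
Qed.

Lemma cvg_sumr (R : realType) (T I : Type) (F : set_system T) (FF : Filter F)
    (r : seq I) (P : pred I) (f : I -> T -> R) (a : I -> R) :
  (forall i, P i -> f i x @[x --> F] --> a i) ->
  (\sum_(i <- r | P i) f i x) @[x --> F] --> \sum_(i <- r | P i) a i.
Proof. by move=> h; apply: cvg_big => //; exact: add_continuous. Qed.

Lemma eq_cvgl (T : Type) (V : nbhsType) (F : set_system T) (f g : T -> V) (a : V) :
  f =1 g -> f x @[x --> F] --> a -> g x @[x --> F] --> a.
Proof. by move=> /funext ->. Qed.

Lemma mul_cvg0_bounded (R : realType) (T : Type) (F : set_system T)
    (FF : Filter F) (f g : T -> R) (M : R) :
  f x @[x --> F] --> 0 -> (forall x, `|g x| <= M) -> f x * g x @[x --> F] --> 0.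
Proof.
move=> f0 gM; apply: norm_cvg0.
apply: (@squeeze_cvgr _ _ _ _ (cst 0) (fun x => `|f x| * M)).
- near=> x; rewrite normr_ge0/= normrM ler_wpM2l//; exact: gM.
- exact: cvg_cst.
- rewrite -[X in _ --> X](mul0r M) -[X in X * M](@normr0 R R).
  by apply: cvgM; [exact: cvg_norm|exact: cvg_cst].
Unshelve. all: by end_near. Qed.

Lemma cvg_of_quotient (R : realType) (f : R -> R) (a b : R) :
  t^-1 * (f t - a) @[t --> 0^'] --> b -> f t @[t --> 0^'] --> a.
Proof.
move=> h; rewrite -[a]addr0 -[X in a + X](mul0r b).
have : (a + t * (t^-1 * (f t - a))) @[t --> (0:R)^'] --> a + 0 * b.
  apply: cvgD; first exact: cvg_cst.
  by apply: cvgM => //; apply: cvg_within_filter; exact: cvg_id.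
apply: cvg_trans; apply: near_eq_cvg; near=> t.
have t0 : t != 0 by near: t; exact: nbhs_dnbhs_neq.
by rewrite mulVKf// addrC subrK.
Unshelve. all: by end_near. Qed.

(* With Q = H^T H_t, the entries r_kij = Q_ik Q_jk of the perturbed spectral
   projections in the basis H satisfy
   (l_t k - l i) r_kij = sum_m (H^T (W_t - W_0) H)_im r_kmj;
   this yields the derivatives of eigenvalues and of spectral functions without
   following individual eigenvectors, whose signs may jump with t. *)
Section spectral_perturbation.
Variables (R : realType) (p : nat).
Variables (W0 W1 H : 'M[R]_p) (l : 'rV[R]_p).
Variables (Wt Ht : R -> 'M[R]_p) (lt : R -> 'rV[R]_p).
Hypothesis spec0 : spectral_dec W0 H l.
Hypothesis spect : forall t, spectral_dec (Wt t) (Ht t) (lt t).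
Hypothesis l_inj : forall i j, i != j -> l 0 i != l 0 j.
Hypothesis W'E : forall a b,
  t^-1 * (Wt t a b - W0 a b) @[t --> 0^'] --> W1 a b.

Let K := H^T *m W1 *m H.
Let E t := H^T *m (Wt t - W0) *m H.
Let Q t := H^T *m Ht t.
Let r t k i j := Q t i k * Q t j k.

Let HTH : H^T *m H = 1%:M. Proof. by case: spec0. Qed.
Let HHT : H *m H^T = 1%:M. Proof. exact: mulmx1C. Qed.
Let QQT t : Q t *m (Q t)^T = 1%:M.
Proof.
have [/mulmx1C HHt _ _] := spect t.
by rewrite /Q trmx_mul trmxK mulmxA -(mulmxA _ (Ht t)) HHt mulmx1.
Qed.

Let r_sum t i j : \sum_k r t k i j = (i == j)%:R.
Proof.
have /matrixP/(_ i j) := QQT t; rewrite !mxE => <-.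
by apply: eq_bigr => k _; rewrite [_^T _ _]mxE.
Qed.

Let Q_le1 t i k : `|Q t i k| <= 1.
Proof.
have : \sum_k r t k i i = 1 by rewrite r_sum eqxx.
rewrite /r (bigD1 k)//= => h.
have : 0 <= \sum_(k' | k' != k) Q t i k' * Q t i k'.
  by apply: sumr_ge0 => k' _; rewrite -expr2 sqr_ge0.
move=> h0; rewrite -(@expr_le1 _ 2)// real_normK ?num_real//.
by rewrite -[leRHS]h expr2 lerDl.
Qed.

Let r_le1 t k i j : `|r t k i j| <= 1.
Proof. by rewrite normrM -[leRHS]mulr1 ler_pM. Qed.

(** Since H and H_t diagonalise W_0 and W_t, E Q = Q diag(l_t) - diag(l) Q; this is its (i, k) entry
    times Q_jk. *)
Let r_comm t k i j :
  (lt t 0 k - l 0 i) * r t k i j = \sum_m E t i m * r t k m j.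
Proof.
have EQ : E t *m Q t = Q t *m diag_mx (lt t) - diag_mx l *m Q t.
  rewrite /E /Q; have [HtT -> _] := spect t; have [_ -> _] := spec0.
  rewrite mulmxBr mulmxBl mulmxBl !mulmxA HTH mul1mx.
  rewrite -(mulmxA _ H H^T) HHT mulmx1 -(mulmxA _ H H^T) HHT mulmx1.
  by rewrite -(mulmxA _ (Ht t)^T) HtT mulmx1.
have /matrixP/(_ i k) := EQ.
have -> : (Q t *m diag_mx (lt t) - diag_mx l *m Q t) i k =
    Q t i k * lt t 0 k - l 0 i * Q t i k.
  rewrite mul_mx_diag mul_diag_mx; move: (Q t) => q; by rewrite !mxE.
rewrite mxE => h.
under eq_bigr do rewrite /r mulrA.
rewrite -mulr_suml h /r; ring.
Qed.

Let E_cvg i j : t^-1 * E t i j @[t --> 0^'] --> K i j.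
Proof.
have -> : (fun t => t^-1 * E t i j) = (fun t => \sum_b
   (\sum_a H a i * (t^-1 * (Wt t a b - W0 a b))) * H b j).
  apply/funext => t; rewrite /E mxE mulr_sumr; apply: eq_bigr => b _.
  rewrite mxE mulrA mulr_sumr; congr (_ * _); apply: eq_bigr => a _.
  by rewrite !mxE; ring.
rewrite /K mxE; apply: cvg_sumr => b _; apply: cvgM; last exact: cvg_cst.
rewrite mxE; apply: cvg_sumr => a _; rewrite mxE.
by apply: cvgM => //; exact: cvg_cst.
Qed.

Let E_cvg0 i j : E t i j @[t --> 0^'] --> 0.
Proof.
apply: (@cvg_of_quotient _ _ _ (K i j)).
apply: eq_cvgl (@E_cvg i j) => t; by rewrite subr0.
Qed.

(** Weyl's inequality between W_0 and W_t, used in both directions, squeezes l_t; the decreasing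
    order is what pairs the k-th eigenvalues. *)
Lemma eigval_cvg k : lt t 0 k @[t --> 0^'] --> l 0 k.
Proof.
pose e t := \sum_a \sum_b `|(Wt t - W0) a b|.
have e0 : e t @[t --> 0^'] --> 0.
  have s0 : \sum_(a : 'I_p) \sum_(b : 'I_p) (0 : R) = 0.
    by rewrite big1// => a _; rewrite big1.
  rewrite -[X in _ --> X]s0.
  apply: cvg_sumr => a _; apply: cvg_sumr => b _.
  apply: (@eq_cvgl _ _ _ (fun t => `|Wt t a b - W0 a b|)) => [t|].
    by rewrite !mxE.
  rewrite -[X in _ --> X](@normr0 R R) -[X in `|X|](subrr (W0 a b)).
  apply: cvg_norm; apply: cvgB; last exact: cvg_cst.
  exact: cvg_of_quotient (@W'E a b).
apply: (@squeeze_cvgr _ _ _ _ (fun t => l 0 k - e t) (fun t => l 0 k + e t)).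
- near=> t; apply/andP; split; last exact: (weyl_le spec0 (spect t)).
  rewrite lerBlDr; apply: le_trans (weyl_le (spect t) spec0 k) _.
  rewrite lerD2l /e; apply: ler_sum => a _; apply: ler_sum => b _.
  by rewrite !mxE distrC.
- rewrite -[X in _ --> X]subr0; apply: cvgB => //; exact: cvg_cst.
- rewrite -[X in _ --> X]addr0; apply: cvgD => //; exact: cvg_cst.
Unshelve. all: by end_near. Qed.

Let gap_inv_cvg k i : k != i ->
  (lt t 0 k - l 0 i)^-1 @[t --> 0^'] --> (l 0 k - l 0 i)^-1.
Proof.
move=> ki; apply: cvgV; first by rewrite subr_eq0 l_inj.
by apply: cvgB; [exact: eigval_cvg|exact: cvg_cst].
Qed.

Let gap_neq0 k i : k != i -> \forall t \near 0^', lt t 0 k - l 0 i != 0.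
Proof.
move=> ki; have : lt t 0 k - l 0 i @[t --> 0^'] --> l 0 k - l 0 i.
  by apply: cvgB; [exact: eigval_cvg|exact: cvg_cst].
have n0 : l 0 k - l 0 i != 0 by rewrite subr_eq0 l_inj.
by move=> h; exact: (cvgr_neq0 _ h n0).
Qed.

(** The gap l_t k - l i stays away from 0 near t = 0, while E tends to 0 and r is bounded, so
    [r_comm] can be divided by the gap. *)
Let r_cvg0 k i j : k != i -> r t k i j @[t --> 0^'] --> 0.
Proof.
move=> ki.
have : (lt t 0 k - l 0 i)^-1 * \sum_m E t i m * r t k m j
    @[t --> 0^'] --> (l 0 k - l 0 i)^-1 * \sum_(m < p) 0.
  apply: cvgM; first exact: gap_inv_cvg.
  apply: cvg_sumr => m _; apply: (@mul_cvg0_bounded _ _ _ _ _ _ 1) => //.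
rewrite big1// mulr0; apply: cvg_trans; apply: near_eq_cvg.
near=> t; rewrite -r_comm mulKf//.
by near: t; exact: gap_neq0.
Unshelve. all: by end_near. Qed.

Let r_cvg k i j : r t k i j @[t --> 0^'] --> (((k == i) && (k == j))%:R : R).
Proof.
have [ki/=|ki] := eqVneq k i; last exact: r_cvg0.
have [kj|kj] := eqVneq k j; last first.
  by apply: eq_cvgl (@r_cvg0 k j i kj) => t; rewrite /r mulrC.
(* The diagonal entry has no gap to divide by; it is 1 minus the entries r_k'kk with k' <> k, which
   tend to 0. *)
subst i j; have -> : (fun t => r t k k k) =
   (fun t => 1 - \sum_(k' | k' != k) r t k' k k).
  apply/funext => t; have : \sum_k' r t k' k k = 1 by rewrite r_sum eqxx.
  by rewrite (bigD1 k)//= => h; rewrite -[X in X - _]h addrK.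
rewrite -[X in _ --> X]subr0; apply: cvgB; first exact: cvg_cst.
have s0 : \sum_(k' < p | k' != k) (0 : R) = 0 by rewrite big1.
rewrite -[X in _ --> X]s0.
by apply: cvg_sumr => k' k'k; exact: r_cvg0.
Qed.

Let Er_cvg k i j : \sum_m (t^-1 * E t i m) * r t k m j @[t --> 0^']
  --> K i k * (k == j)%:R.
Proof.
have -> : K i k * (k == j)%:R = \sum_m K i m * ((k == m) && (k == j))%:R.
  rewrite (bigD1 k)//= eqxx big1 ?addr0// => m mk.
  by rewrite eq_sym (negbTE mk) mulr0.
by apply: cvg_sumr => m _; apply: cvgM.
Qed.

(** First-order perturbation of a simple eigenvalue: in [r_comm] with i = j = k, the factor r_kkk
    tends to 1 and can be divided out. *)
Lemma eigval_quotient_cvg k :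
  t^-1 * (lt t 0 k - l 0 k) @[t --> 0^'] --> K k k.
Proof.
have r1 : r t k k k @[t --> 0^'] --> (1 : R).
  by have := @r_cvg k k k; rewrite eqxx.
have rn0 : \forall t \near 0^', r t k k k != 0.
  by apply: (cvgr_neq0 _ r1); exact: oner_neq0.
have : (\sum_m (t^-1 * E t k m) * r t k m k) * (r t k k k)^-1
   @[t --> 0^'] --> (K k k * (k == k)%:R) * 1^-1.
  by apply: cvgM => //; apply: cvgV => //; exact: oner_neq0.
rewrite eqxx invr1 !mulr1; apply: cvg_trans; apply: near_eq_cvg.
near=> t; under eq_bigr do rewrite -mulrA.
rewrite -mulr_sumr -r_comm mulrA mulfK//.
by near: t.
Unshelve. all: by end_near. Qed.

Variables (phi : R -> 'rV[R]_p) (c dc : 'rV[R]_p).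
Hypothesis phi_cvg : forall i,
  t^-1 * (phi t 0 i - c 0 i) @[t --> 0^'] --> dc 0 i.

(** Daleckii-Krein form, in the basis H, of the derivative of H_t diag(phi t) H_t^T: divided
    differences of c times K off the diagonal. The curve [phi] is kept general because each g_i
    depends on all eigenvalues. *)
Definition dspectral : 'M[R]_p := \matrix_(i, j)
  if i == j then dc 0 i else (c 0 i - c 0 j) / (l 0 i - l 0 j) * K i j.

(** As sum_k r_kij = delta_ij, the quotient is sum_k t^-1 (phi_k - c_i) r_kij. The term k = i brings
    in dc_i; for k <> i, [r_comm] trades t^-1 r_kij for t^-1 E r divided by the gap, and only k = j
    survives in the limit. *)
Let N_cvg i j : t^-1 * (\sum_k phi t 0 k * r t k i j - c 0 i * (i == j)%:R)
  @[t --> 0^'] --> dspectral i j.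
Proof.
have -> : (fun t => t^-1 * (\sum_k phi t 0 k * r t k i j - c 0 i * (i == j)%:R))
   = (fun t => \sum_k t^-1 * (phi t 0 k - c 0 i) * r t k i j).
  apply/funext => t; rewrite -(r_sum t) mulr_sumr -sumrB mulr_sumr.
  by apply: eq_bigr => k _; ring.
have -> : dspectral i j = \sum_k if k == i then dc 0 i * (i == j)%:R else
   (c 0 k - c 0 i) / (l 0 k - l 0 i) * (K i k * (k == j)%:R).
  rewrite mxE (bigD1 i)//= eqxx.
  have [ij|ij] := eqVneq i j.
    rewrite mulr1 big1 ?addr0// => k ki.
    by rewrite (negbTE ki) -ij (negbTE ki) !mulr0.
  have ji : j != i by rewrite eq_sym.
  rewrite mulr0 add0r (bigD1 j)//= (negbTE ji) eqxx.
  rewrite big1 ?addr0 ?mulr1 => [|k /andP[ki kj]].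
    rewrite -(opprB (c 0 j)) -(opprB (l 0 j)) invrN mulrNN; ring.
  by rewrite (negbTE ki) (negbTE kj) !mulr0.
apply: cvg_sumr => k _; case: (eqVneq k i) => [->|ki].
  apply: cvgM => //; have := @r_cvg i i j; by rewrite eqxx.
have : (phi t 0 k - c 0 i) * (lt t 0 k - l 0 i)^-1 *
    (\sum_m (t^-1 * E t i m) * r t k m j)
   @[t --> 0^'] --> (c 0 k - c 0 i) / (l 0 k - l 0 i) * (K i k * (k == j)%:R).
  apply: cvgM => //; apply: cvgM; last exact: gap_inv_cvg.
  by apply: cvgB; [exact: cvg_of_quotient (@phi_cvg k)|exact: cvg_cst].
apply: cvg_trans; apply: near_eq_cvg; near=> t.
under eq_bigr do rewrite -mulrA.
rewrite -mulr_sumr -r_comm.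
have : lt t 0 k - l 0 i != 0 by near: t; exact: gap_neq0.
by move: (t^-1) => ti h; rewrite -[LHS]mulrA [_^-1 * _]mulrCA mulKf//; ring.
Unshelve. all: by end_near. Qed.

Lemma spectral_fun_quotient_cvg a b :
  t^-1 * ((Ht t *m diag_mx (phi t) *m (Ht t)^T) a b
          - (H *m diag_mx c *m H^T) a b) @[t --> 0^']
  --> (H *m dspectral *m H^T) a b.
Proof.
have -> : (fun t => t^-1 * ((Ht t *m diag_mx (phi t) *m (Ht t)^T) a b
          - (H *m diag_mx c *m H^T) a b)) = (fun t => \sum_j (\sum_i H a i *
   (t^-1 * (\sum_k phi t 0 k * r t k i j - c 0 i * (i == j)%:R))) * H b j).
  apply/funext => t.
  have -> : Ht t *m diag_mx (phi t) *m (Ht t)^T =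
     H *m (Q t *m diag_mx (phi t) *m (Q t)^T) *m H^T.
    by rewrite /Q trmx_mul trmxK !mulmxA HHT mul1mx -(mulmxA _ H H^T) HHT mulmx1.
  have <- : (H *m (Q t *m diag_mx (phi t) *m (Q t)^T) *m H^T
     - H *m diag_mx c *m H^T) a b =
    (H *m (Q t *m diag_mx (phi t) *m (Q t)^T) *m H^T) a b
     - (H *m diag_mx c *m H^T) a b by rewrite mxE [X in _ + X]mxE.
  rewrite -mulmxBl -mulmxBr mxE mulr_sumr; apply: eq_bigr => j _.
  rewrite mxE [H^T _ _]mxE mulrA mulr_sumr; congr (_ * _).
  apply: eq_bigr => i _; rewrite mulrCA; congr (_ * (_ * _)).
  rewrite mul_mx_diag 2![in LHS]mxE [X in _ + X]mxE [diag_mx _ _ _]mxE mulr_natr.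
  congr (_ - _); apply: eq_bigr => k _.
  rewrite /r; move: (Q t) => q; rewrite !mxE; ring.
rewrite mxE; apply: cvg_sumr => j _; apply: cvgM; last first.
  by rewrite mxE; exact: cvg_cst.
rewrite mxE; apply: cvg_sumr => i _; apply: cvgM; [exact: cvg_cst|exact: N_cvg].
Qed.

End spectral_perturbation.

(** * Divergence of the shrinkage field *)

(** Chain rule, meant for the curve of eigenvalues, of which only coordinatewise difference
    quotients at 0 are known. *)
Lemma curve_quotient_cvg (R : realType) (p : nat) (f : 'rV[R]_p -> R)
    (y : R -> 'rV[R]_p) (v : 'rV[R]_p) :
  differentiable f (y 0) ->
  (forall k, t^-1 * (y t 0 k - y 0 0 k) @[t --> 0^'] --> v 0 k) ->
  t^-1 * (f (y t) - f (y 0)) @[t --> 0^']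
    --> \sum_k v 0 k * 'D_(delta_mx 0 k) f (y 0).
Proof.
move=> df dy.
have qE (h : R -> R) : (fun t => t^-1 * (h t - h 0)) =
    (fun t : R => t^-1 *: ((h \o shift 0) (t *: (1 : R)) - h 0)).
  by apply/funext => t /=; rewrite addr0 /GRing.scale/= mulr1.
have derk k : derivable (fun t => y t 0 k) 0 1.
  by apply/cvg_ex; exists (v 0 k); rewrite -(qE (fun t => y t 0 k)).
have Dk k : 'D_1 (fun t => y t 0 k) 0 = v 0 k.
  by apply: norm_cvg_lim; rewrite -(qE (fun t => y t 0 k)).
have dery : derivable y 0 1.
  by apply/derivable_mxP => i k; rewrite (ord1 i).
have diffy : differentiable y 0 by apply/derivable1_diffP.
have dfy : differentiable (f \o y) 0 by exact: differentiable_comp.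
have derfy : derivable (f \o y) 0 1 by exact: diff_derivable.
rewrite (qE (f \o y)).
have -> : \sum_k v 0 k * 'D_(delta_mx 0 k) f (y 0) = 'D_1 (f \o y) 0.
  rewrite deriveE// diff_comp//= -(deriveE (1 : R) diffy) (derive_mx dery).
  rewrite [X in 'd f _ X](row_sum_delta) linear_sum; apply: eq_bigr => k _.
  by rewrite linearZ/= mxE Dk deriveE.
exact: derfy.
Qed.

Lemma mulmx_delta (R : realType) (p q m n : nat) (A : 'M[R]_(p, q))
  (B : 'M[R]_(m, n)) a b i j : (A *m delta_mx a b *m B) i j = A i a * B b j.
Proof.
rewrite mxE (bigD1 b)//= big1 ?addr0 => [|k kb]; last first.
  rewrite mxE big1 ?mul0r// => e _.
  by rewrite mxE (negbTE kb) andbF mulr0.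
rewrite mxE (bigD1 a)//= big1 ?addr0 => [|k ka]; last first.
  by rewrite mxE (negbTE ka) mulr0.
by rewrite mxE !eqxx mulr1.
Qed.

Lemma exchange_big4 (R : realType) (I J : finType) (f : I -> I -> I -> J -> R) :
  \sum_i \sum_j \sum_a \sum_b f i j a b = \sum_a \sum_b \sum_i \sum_j f i j a b.
Proof.
transitivity (\sum_i \sum_a \sum_j \sum_b f i j a b).
  by apply: eq_bigr => i _; exact: exchange_big.
rewrite exchange_big; apply: eq_bigr => a _.
rewrite [RHS]exchange_big; apply: eq_bigr => i _; exact: exchange_big.
Qed.

Section divergence.
Variables (R : realType) (p m : nat).
Variables (eigvec : 'M[R]_p -> 'M[R]_p) (eigval : 'M[R]_p -> 'rV[R]_p).
Variable g : 'I_p -> 'rV[R]_p -> R.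
Hypothesis spec : forall W, mxsym W -> spectral_dec W (eigvec W) (eigval W).
Variable Y : 'M[R]_(p, m).
Let l := eigval (Y *m Y^T).
Let H := eigvec (Y *m Y^T).
Let U := H^T *m Y.
Hypothesis l_inj : forall i j, i != j -> l 0 i != l 0 j.
Hypothesis dg : forall i, differentiable (g i) l.

Let gram_sym (V : 'M[R]_(p, m)) : mxsym (V *m V^T).
Proof. by rewrite /mxsym trmx_mul trmxK. Qed.

Let dgram a b := delta_mx a b *m Y^T + Y *m (delta_mx a b)^T.
Let K a b := H^T *m dgram a b *m H.
Let dc a b : 'rV[R]_p := \row_i \sum_k K a b k k * 'D_(delta_mx 0 k) (g i) l.
Let c : 'rV[R]_p := \row_i g i l.
Let D a b := dspectral (dgram a b) H l c (dc a b).

(** Product rule for M(V) V with M = H G H^T: moving the factor V along [delta_mx a b] contributes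
    M_aa, moving M contributes (M' Y)_ab. *)
Lemma shrinkY_derive a b :
  'D_(delta_mx a b) (fun V => shrinkY eigvec eigval g V a b) Y
  = (H *m diag_mx c *m H^T) a a + \sum_e (H *m D a b *m H^T) a e * Y e b.
Proof.
pose Vt (t : R) := t *: delta_mx a b + Y.
pose Wt t := Vt t *m (Vt t)^T.
pose lt t := eigval (Wt t); pose Ht t := eigvec (Wt t).
have V0 : Vt 0 = Y by rewrite /Vt scale0r add0r.
have W'E i j : t^-1 * (Wt t i j - (Y *m Y^T) i j) @[t --> 0^'] --> dgram a b i j.
  have : dgram a b i j + t * (delta_mx a b *m (delta_mx a b)^T) i j
      @[t --> (0:R)^'] --> dgram a b i j + 0 * (delta_mx a b *m (delta_mx a b)^T) i j.
    apply: cvgD; first exact: cvg_cst.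
    apply: cvgM; last exact: cvg_cst.
    by apply: cvg_within_filter; exact: cvg_id.
  rewrite mul0r addr0; apply: cvg_trans; apply: near_eq_cvg; near=> t.
  have t0 : t != 0 by near: t; exact: nbhs_dnbhs_neq.
  have -> : Wt t = t *: (t *: (delta_mx a b *m (delta_mx a b)^T) + dgram a b) + Y *m Y^T.
    rewrite /Wt /Vt /dgram [(_ + _)^T]linearD/= [(_ *: _)^T]linearZ/=.
    by rewrite mulmxDl !mulmxDr -!scalemxAl -!scalemxAr !scalerDr !addrA.
  by rewrite !mxE addrK mulKf// addrC.
have spec0 := spec (gram_sym Y).
have spect t := spec (gram_sym (Vt t)).
have eig k := @eigval_quotient_cvg _ _ _ _ _ _ Wt Ht lt spec0 spect l_inj W'E k.
have phi_cvg i : t^-1 * ((\row_j g j (lt t)) 0 i - c 0 i) @[t --> 0^'] --> dc a b 0 i.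
  have lt0 : lt 0 = l by rewrite /lt /Wt V0.
  have -> : dc a b 0 i = \sum_k (\row_k K a b k k) 0 k * 'D_(delta_mx 0 k) (g i) (lt 0).
    by rewrite mxE lt0; apply: eq_bigr => k _; rewrite mxE.
  have dgt : differentiable (g i) (lt 0) by rewrite lt0.
  apply: eq_cvgl (curve_quotient_cvg dgt _) => [t|k].
    by rewrite !mxE lt0.
  by rewrite lt0 [X in _ --> X]mxE; exact: eig.
have Mcvg i j := @spectral_fun_quotient_cvg _ _ _ _ _ _ Wt Ht lt spec0 spect
  l_inj W'E (fun t => \row_j g j (lt t)) c (dc a b) phi_cvg i j.
apply: norm_cvg_lim.
pose Mt t := Ht t *m diag_mx (\row_j g j (lt t)) *m (Ht t)^T.
(* The (a, b) entry of M_t V_t - M_0 Y = t M_t delta_ab + (M_t - M_0) Y, divided by t. *)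
have : Mt t a a + \sum_e t^-1 * (Mt t a e - (H *m diag_mx c *m H^T) a e) * Y e b
  @[t --> 0^'] --> (H *m diag_mx c *m H^T) a a + \sum_e (H *m D a b *m H^T) a e * Y e b.
  apply: cvgD; first exact: cvg_of_quotient (@Mcvg a a).
  by apply: cvg_sumr => e _; apply: cvgM; [exact: Mcvg|exact: cvg_cst].
apply: cvg_trans; apply: near_eq_cvg; near=> t.
have t0 : t != 0 by near: t; exact: nbhs_dnbhs_neq.
rewrite /= /shift/= /shrinkY /Gmat -/(Vt t) -/(Wt t) -/(Mt t) -/H -/c -/l.
rewrite [X in X - _]mxE [X in _ - X]mxE -sumrB /GRing.scale/= mulr_sumr.
rewrite [in RHS](bigD1 a)//= [in LHS](bigD1 a)//= addrA; congr (_ + _).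
  rewrite [Vt t a b]mxE [X in X + Y a b]mxE [delta_mx _ _ _ _]mxE !eqxx /=.
  move: (Mt t a a) ((H *m diag_mx c *m H^T) a a) => x1 x2; rewrite mulr1; by field.
apply: eq_bigr => e ea; rewrite [Vt t e b]mxE [X in X + Y e b]mxE [delta_mx _ _ _ _]mxE.
by rewrite (negbTE ea) mulr0 add0r -mulrBl mulrA.
Unshelve. all: by end_near. Qed.

Let HTH : H^T *m H = 1%:M. Proof. by case: (spec (gram_sym Y)). Qed.

Let UU i j : \sum_b U i b * U j b = l 0 i * (i == j)%:R.
Proof.
have : (U *m U^T) i j = l 0 i * (i == j)%:R.
  rewrite /U trmx_mul trmxK mulmxA -(mulmxA _ Y).
  have [_ -> _] := spec (gram_sym Y).
  by rewrite !mulmxA -/H HTH mul1mx -mulmxA HTH mulmx1 mxE mulr_natr.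
by move=> <-; rewrite mxE; apply: eq_bigr => b _; rewrite [_^T _ _]mxE.
Qed.

Let HH i j : \sum_a H a i * H a j = (i == j)%:R.
Proof.
have /matrixP/(_ i j) := HTH; rewrite !mxE => <-.
by apply: eq_bigr => a _; rewrite mxE.
Qed.

Let KE a b i j : K a b i j = H a i * U j b + U i b * H a j.
Proof.
have YH : Y^T *m H = U^T by rewrite /U trmx_mul trmxK.
rewrite /K /dgram mulmxDr mulmxDl mxE !mulmxA trmx_delta -(mulmxA _ Y^T) YH.
by rewrite !mulmx_delta [H^T _ _]mxE [U^T _ _]mxE.
Qed.

(* The columns of H are orthonormal and the rows of U are orthogonal with squared
   norms l. *)
Let sumHUK i j k e : \sum_a \sum_b H a i * U j b * K a b k e
  = (i == k)%:R * (l 0 j * (j == e)%:R) + (i == e)%:R * (l 0 j * (j == k)%:R).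
Proof.
rewrite -(UU j e) -(UU j k) -(HH i k) -(HH i e) !mulr_suml -big_split/=; apply: eq_bigr => a _.
rewrite !mulr_sumr -big_split/=; apply: eq_bigr => b _; rewrite KE; ring.
Qed.

Let shrinkM_trace : \tr (H *m diag_mx c *m H^T) = \sum_i g i l.
Proof.
rewrite mxtrace_mulC mulmxA HTH mul1mx mxtrace_diag.
by apply: eq_bigr => i _; rewrite mxE.
Qed.

Lemma shrinkY_divergence :
  \sum_a \sum_b 'D_(delta_mx a b) (fun V => shrinkY eigvec eigval g V a b) Y
  = \sum_i (m%:R * g i l
      + l 0 i * (\sum_(k | k != i) (g i l - g k l) / (l 0 i - l 0 k))
      + 2 * (l 0 i * 'D_(delta_mx 0 i) (g i) l)).
Proof.
pose G i j := (g i l - g j l) / (l 0 i - l 0 j).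
have DE a b i j : D a b i j = if i == j then
    \sum_k K a b k k * 'D_(delta_mx 0 k) (g i) l else G i j * K a b i j.
  by rewrite mxE; case: ifP => _; rewrite !mxE.
transitivity (\sum_(a < p) \sum_(b < m) (H *m diag_mx c *m H^T) a a
  + \sum_i \sum_j \sum_a \sum_b H a i * U j b * D a b i j).
  rewrite [X in _ + X](_ : _ = \sum_a \sum_b \sum_e (H *m D a b *m H^T) a e * Y e b).
    rewrite -big_split/=; apply: eq_bigr => a _.
    by rewrite -big_split/=; apply: eq_bigr => b _; exact: shrinkY_derive.
  rewrite exchange_big4; apply: eq_bigr => a _; apply: eq_bigr => b _.
  transitivity ((H *m D a b *m U) a b); last first.
    by rewrite /U mulmxA mxE.
  rewrite mxE exchange_big/=; apply: eq_bigr => j _.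
  rewrite [(H *m _) a j]mxE mulr_suml; by apply: eq_bigr => i _; rewrite mulrAC.
(* By [sumHUK], for i = j only k = i contributes, so only the derivative of g_i in its own
   eigenvalue survives, with factor 2; for i <> j the pairing leaves l_j. *)
have sumD i j : \sum_a \sum_b H a i * U j b * D a b i j = if i == j then
    2 * (l 0 i * 'D_(delta_mx 0 i) (g i) l) else l 0 j * G i j.
  have [<-|ij] := eqVneq i j.
    transitivity (\sum_k (\sum_a \sum_b H a i * U i b * K a b k k) *
        'D_(delta_mx 0 k) (g i) l).
      under [RHS]eq_bigr do rewrite mulr_suml.
      rewrite [RHS]exchange_big/=; apply: eq_bigr => a _.
      under [RHS]eq_bigr do rewrite mulr_suml.
      rewrite [RHS]exchange_big/=; apply: eq_bigr => b _.
      rewrite DE eqxx mulr_sumr; apply: eq_bigr => k _; ring.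
    under eq_bigr do rewrite sumHUK.
    rewrite (bigD1 i)//= big1 ?eqxx => [|k ki]; first by rewrite mulr1n; ring.
    by rewrite eq_sym (negbTE ki) !mul0r addr0 mul0r.
  transitivity (G i j * \sum_a \sum_b H a i * U j b * K a b i j).
    rewrite mulr_sumr; apply: eq_bigr => a _.
    by rewrite mulr_sumr; apply: eq_bigr => b _; rewrite DE (negbTE ij) mulrCA.
  by rewrite sumHUK !eqxx (negbTE ij) mulr1n mulr0n; ring.
rewrite !big_split/= -addrA; congr (_ + _).
  rewrite exchange_big/=.
  under eq_bigr do rewrite -/(\tr _) shrinkM_trace.
  by rewrite sumr_const card_ord -mulr_sumr mulr_natl.
(* Symmetry of the divided difference lets the exchange of i and j turn the weight l_j into l_i. *)
have GC i j : G i j = G j i.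
  by rewrite /G -(opprB (l 0 j)) -(opprB (g j l)) invrN mulrNN.
transitivity (\sum_i 2 * (l 0 i * 'D_(delta_mx 0 i) (g i) l)
  + \sum_i \sum_(j | j != i) l 0 j * G i j).
  rewrite -big_split/=; apply: eq_bigr => i _.
  rewrite (bigD1 i)//= sumD eqxx; congr (_ + _); apply: eq_bigr => j ji.
  by rewrite sumD eq_sym (negbTE ji).
rewrite addrC; congr (_ + _); rewrite (exchange_big_dep xpredT)//=.
apply: eq_bigr => j _; rewrite mulr_sumr; apply: eq_big => [i|i ij].
  by rewrite eq_sym.
by rewrite GC.
Qed.

End divergence.

(** * Null sets of Gaussian matrices *)

Section independent_section.
Context d (T : measurableType d) (R : realType) (P : probability T R).
Variable G : set (set T).
Hypothesis Gm : G `<=` measurable.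
Hypothesis GI : setI_closed G.
Hypothesis GT : G setT.
Let T1 := g_sigma_algebraType G.
Variables (U : T -> measurableTypeR R) (nu : probability (measurableTypeR R) R).
Hypothesis mU : measurable_fun setT U.
Hypothesis indep : forall A B, G A -> measurable B ->
  P (A `&` U @^-1` B) = (P A * nu B)%E.

Let sGm (A : set T) : <<s G >> A -> measurable A.
Proof. exact: (smallest_sub (@sigma_algebra_measurable _ T) Gm). Qed.

(** Both sides are finite measures in A that agree on the pi-system G, hence on the sigma-algebra it
    generates. *)
Let indep_sigma (A : set T) B : <<s G >> A -> measurable B ->
  P (A `&` U @^-1` B) = (P A * nu B)%E.
Proof.
move=> sA mB.
have mUB : measurable (U @^-1` B) by rewrite -[_ @^-1` _]setTI; exact: mU.
have nuBfin := fin_num_measure nu B mB.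
pose m1 := mrestr P mUB.
pose m2 := mscale (NngNum (fine_ge0 (measure_ge0 nu B))) P.
have m2E X : m2 X = (P X * nu B)%E by rewrite /m2/= /mscale/= fineK// muleC.
rewrite -m2E -[LHS]/(m1 A).
apply: (@g_sigma_algebra_measure_unique _ _ _ G Gm (fun=> setT)) => //.
- by rewrite bigcup_const//; exists 0%N.
- by move=> X GX; rewrite -[RHS]/(m2 X) m2E; exact: indep.
- move=> _; apply: (@le_lt_trans _ _ 1%E); last exact: ltry.
  rewrite -[X in (X <= _)%E]/(P (setT `&` U @^-1` B)).
  by apply: probability_le1; exact: measurableI.
Qed.

(* Fubini for the joint law of the identity on (T, sigma(G)) and of U, which is
   a product measure by independence. *)
Lemma independent_null_section (D : set (T1 * measurableTypeR R)) (N : set T) :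
  measurable D -> <<s G >> N -> P N = 0%E ->
  (forall w, ~ N w -> nu (xsection D w) = 0%E) ->
  P [set w | D (w, U w)] = 0%E.
Proof.
move=> mD sN PN sec.
have mid : measurable_fun setT (id : T -> T1).
  by move=> _ A mA; rewrite setTI; exact: sGm.
pose X1 : {mfun T >-> T1} :=
  HB.pack (id : T -> T1) (isMeasurableFun.Build _ _ _ _ _ mid).
pose V (w : T) : T1 * measurableTypeR R := (w, U w).
have mV : measurable_fun setT V by exact: measurable_fun_pair.
pose X : {mfun T >-> (T1 * measurableTypeR R)%type} :=
  HB.pack V (isMeasurableFun.Build _ _ _ _ _ mV).
have -> : P [set w | D (w, U w)] = distribution P X D by [].
have <- : (distribution P X1 \x nu)%E D = distribution P X D.
  by apply: product_measure_unique => //.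
rewrite /product_measure1.
rewrite (ae_eq_integral (cst 0%E)) ?integral0//.
- exact: measurable_fun_xsection.
- exists N; split => //.
  by move=> w /= h; apply: contrapT => /sec e; apply: h.
Qed.

End independent_section.

Lemma poly_roots_seq (R : fieldType) (q : {poly R}) : q != 0 ->
  exists rs : seq R, forall t, q.[t] = 0 -> t \in rs.
Proof.
have [k] := ubnP (size q); elim: k q => // k IH q; rewrite ltnS => sq q0.
have [[a /eqP qa]|no] := pselect (exists a, q.[a] = 0); last first.
  by exists [::] => t qt; exfalso; apply: no; exists t.
have /factor_theorem[q1 qE] := qa.
have q10 : q1 != 0 by apply: contraNneq q0 => q10; rewrite qE q10 mul0r.
have [|rs rsP] := IH q1 _ q10.
  by move: sq; rewrite qE size_Mmonic ?monicXsubC// size_XsubC addn2.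
exists (a :: rs) => t; rewrite qE hornerM => /eqP.
rewrite mulf_eq0 in_cons orbC !hornerE subr_eq0 => /orP[->//|/eqP/rsP->].
by rewrite orbT.
Qed.

Lemma normal_prob_roots (R : realType) (m s : R) (q : {poly R}) : q != 0 ->
  normal_prob m s [set t | q.[t] = 0] = 0%E.
Proof.
move=> /poly_roots_seq[rs rsP].
have fin : finite_set [set t | q.[t] = 0].
  by apply: (@sub_finite_set _ _ [set` rs]) => [t /rsP//|]; exact: finite_seq.
have := normal_prob_dominates m s; move/null_content_dominatesP; apply.
  exact: countable_measurable (finite_set_countable fin).
exact: countable_lebesgue_measure0 (finite_set_countable fin).
Qed.

Section iid_normal_matrix.
Context d (T : measurableType d) (R : realType) (P : probability T R).
Variables (p n : nat) (Z : T -> 'M[R]_(p, n)).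
Hypothesis mZ : forall i j, measurable_fun setT (fun w => Z w i j).
Hypothesis Z_normal : forall i j (B : set R), measurable B ->
  P ((fun w => Z w i j) @^-1` B) = normal_prob 0 1 B.
Hypothesis Z_indep : forall B : 'I_p -> 'I_n -> set R,
  (forall i j, measurable (B i j)) ->
  P (\big[setI/setT]_(i < p) \big[setI/setT]_(j < n)
       ((fun w => Z w i j) @^-1` B i j))
  = (\prod_(i < p) \prod_(j < n) P ((fun w => Z w i j) @^-1` B i j))%E.

Let box (B : 'I_p * 'I_n -> set R) : set T :=
  [set w | forall c, B c (Z w c.1 c.2)].

Let boxE (B : 'I_p * 'I_n -> set R) :
  \big[setI/setT]_(i < p) \big[setI/setT]_(j < n)
       ((fun w => Z w i j) @^-1` B (i, j)) = box B.
Proof.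
rewrite pair_bigA/=; apply/seteqP; split => w.
  by rewrite -bigcap_seq => h [i j]; apply: (h (i, j)); rewrite /= mem_index_enum.
by move=> h; rewrite -bigcap_seq => -[i j] _; exact: (h (i, j)).
Qed.

Let box_prob (B : 'I_p * 'I_n -> set R) : (forall c, measurable (B c)) ->
  P (box B) = (\prod_c P ((fun w => Z w c.1 c.2) @^-1` B c))%E.
Proof.
move=> mB; rewrite -boxE (@Z_indep (fun i j => B (i, j)))//.
by rewrite pair_bigA/=; apply: eq_bigr => -[i j].
Qed.

Let box_measurable (B : 'I_p * 'I_n -> set R) : (forall c, measurable (B c)) ->
  measurable (box B).
Proof.
move=> mB; rewrite -boxE; apply: bigsetI_measurable => i _.
apply: bigsetI_measurable => j _; rewrite -[_ @^-1` _]setTI.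
by apply: mZ => //; exact: mB.
Qed.

Variable c : 'I_p * 'I_n.

(** Boxes that leave entry c free: a pi-system for the sigma-algebra of all other entries, so
    independence from entry c has to be checked on boxes only. *)
Definition other_boxes : set (set T) :=
  [set A | exists B : 'I_p * 'I_n -> set R,
    [/\ forall e, measurable (B e), B c = setT & A = box B]].

Lemma other_boxes_measurable : other_boxes `<=` measurable.
Proof. by move=> _ [B [mB _ ->]]; exact: box_measurable. Qed.

Lemma other_boxes_setI : setI_closed other_boxes.
Proof.
move=> _ _ [B [mB Bc ->]] [B' [mB' B'c ->]].
exists (fun e => B e `&` B' e); split.
- by move=> e; exact: measurableI.
- by rewrite Bc B'c setIT.
- by apply/seteqP; split => [w [h h'] e|w h]; [split|split => e; case: (h e)].
Qed.

Lemma other_boxesT : other_boxes setT.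
Proof. by exists (fun=> setT); split => //; apply/seteqP; split. Qed.

Lemma other_boxes_indep A (B : set R) : other_boxes A -> measurable B ->
  P (A `&` (fun w => Z w c.1 c.2) @^-1` B) = (P A * normal_prob 0 1 B)%E.
Proof.
move=> [B0 [mB0 B0c ->]] mB.
pose B1 e := if e == c then B else B0 e.
have -> : box B0 `&` (fun w => Z w c.1 c.2) @^-1` B = box B1.
  apply/seteqP; split => [w [h hc] e|w h].
    by rewrite /B1; case: eqP => [->//|_]; exact: h.
  split => [e|]; last by have := h c; rewrite /B1 eqxx.
  by have := h e; rewrite /B1; case: eqP => // -> _; rewrite B0c.
rewrite !box_prob//; last by move=> e; rewrite /B1; case: ifP.
rewrite (bigD1 c)//= [in RHS](bigD1 c)//= /B1 eqxx B0c preimage_setT.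
rewrite probability_setT mul1e Z_normal// muleC; congr (_ * _)%E.
by apply: eq_bigr => e /negbTE ->.
Qed.

Lemma other_entry_measurable i j : (i, j) != c ->
  measurable_fun setT ((fun w => Z w i j) : g_sigma_algebraType other_boxes -> R).
Proof.
move=> ijc _ B mB; rewrite setTI; apply: sub_sigma_algebra.
exists (fun e => if e == (i, j) then B else setT); split.
- by move=> e; case: ifP.
- by rewrite eq_sym (negbTE ijc).
- apply/seteqP; split => [w h e|w h]; first by case: eqP => [->|].
  by have := h (i, j); rewrite eqxx.
Qed.

End iid_normal_matrix.

Definition upd (R : Type) (p n : nat) (x : 'M[R]_(p, n)) (c : 'I_p * 'I_n) (t : R) :
  'M[R]_(p, n) := \matrix_(i, j) if (i, j) == c then t else x i j.

Definition entrywise_measurable d (T : measurableType d) (R : realType)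
  (p n : nat) (M : T -> 'M[R]_(p, n)) :=
  forall i j, measurable_fun setT (fun w => M w i j).

Section poly_null.
Context d (T : measurableType d) (R : realType) (P : probability T R).
Variables (p n : nat) (Z : T -> 'M[R]_(p, n)).
Hypothesis mZ : forall i j, measurable_fun setT (fun w => Z w i j).
Hypothesis Z_normal : forall i j (B : set R), measurable B ->
  P ((fun w => Z w i j) @^-1` B) = normal_prob 0 1 B.
Hypothesis Z_indep : forall B : 'I_p -> 'I_n -> set R,
  (forall i j, measurable (B i j)) ->
  P (\big[setI/setT]_(i < p) \big[setI/setT]_(j < n)
       ((fun w => Z w i j) @^-1` B i j))
  = (\prod_(i < p) \prod_(j < n) P ((fun w => Z w i j) @^-1` B i j))%E.

Variable f : 'M[R]_(p, n) -> R.
(** Stated for every measurable space: it serves T with the coarser sigma-algebra of the entries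
    other than c, and the product of that space with the real line. *)
Hypothesis f_meas : forall d' (T' : measurableType d') (M : T' -> 'M[R]_(p, n)),
  entrywise_measurable M -> measurable_fun setT (fun w => f (M w)).
Hypothesis f_poly : forall x c, exists q : {poly R}, forall t, f (upd x c t) = q.[t].

(* The entries listed in s are random and the others are frozen at z0; entries
   are released one at a time. *)
Let mix (z0 : 'M[R]_(p, n)) (s : seq ('I_p * 'I_n)) w : 'M[R]_(p, n) :=
  \matrix_(i, j) if (i, j) \in s then Z w i j else z0 i j.

Let mix_null z0 s : f z0 != 0 -> uniq s -> P [set w | f (mix z0 s w) = 0] = 0%E.
Proof.
move=> fz0; elim: s => [_|c s IH /= /andP[cs us]].
  rewrite [X in P X](_ : _ = set0) ?measure0//; apply/seteqP; split => // w /=.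
  suff -> : mix z0 [::] w = z0 by move/eqP; rewrite (negbTE fz0).
  by apply/matrixP => i j; rewrite mxE.
pose T1 := g_sigma_algebraType (other_boxes Z c).
pose mx1 (u : T1 * measurableTypeR R) := upd (mix z0 s (u.1 : T)) c u.2.
have mmix : entrywise_measurable (mix z0 s : T1 -> _).
  move=> i j; under eq_fun do rewrite mxE.
  case: (boolP ((i, j) \in s)) => [ijs|_]; last exact: measurable_cst.
  by apply: other_entry_measurable; apply: contraNneq cs => <-.
have mmx1 : entrywise_measurable mx1.
  move=> i j; rewrite /mx1; under eq_fun do rewrite mxE.
  case: ((i, j) == c); first exact: measurable_snd.
  apply: (@measurable_comp _ _ _ _ _ _ setT (fun w : T1 => mix z0 s w i j)) => //.
have set1E (U : Type) (h : U -> R) : [set u | h u = 0] = setT `&` h @^-1` [set 0].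
  by rewrite setTI.
have upd_mix w : upd (mix z0 s w) c (Z w c.1 c.2) = mix z0 (c :: s) w.
  apply/matrixP => i j; rewrite !mxE in_cons.
  by case: eqP => [<-//|].
have upd_id w : upd (mix z0 s w) c (z0 c.1 c.2) = mix z0 s w.
  apply/matrixP => i j; rewrite !mxE.
  by case: eqP => // ijc; rewrite -ijc in cs; rewrite (negbTE cs) -ijc.
rewrite [X in P X](_ : _ = [set w | [set u | f (mx1 u) = 0]
    ((w : T1), (Z w c.1 c.2 : measurableTypeR R))]); last first.
  by apply/seteqP; split => w; rewrite /mx1/= upd_mix.
apply: (@independent_null_section _ _ _ P _ _ _ _ _ (normal_prob 0 1) _ _ _
   [set w | f (mix z0 s w) = 0]).
- exact: other_boxes_measurable.
- exact: other_boxes_setI.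
- exact: other_boxesT.
- exact: mZ.
- by move=> A B; exact: other_boxes_indep.
- by rewrite set1E; apply: f_meas => //; exact: measurable_set1.
- have := f_meas mmix measurableT (measurable_set1 0).
  by rewrite -set1E.
- exact: IH.
move=> w /eqP Nw; have [q qE] := f_poly (mix z0 s w) c.
have q0 : q != 0.
  by apply: contraNneq Nw => q0; rewrite -upd_id qE q0 horner0.
rewrite -(normal_prob_roots 0 1 q0); congr (normal_prob _ _ _).
by apply/seteqP; split => t; rewrite /xsection/= inE/= /mx1 qE.
Qed.

Lemma normal_matrix_null : (exists z0, f z0 != 0) -> P [set w | f (Z w) = 0] = 0%E.
Proof.
move=> [z0 fz0]; rewrite -(@mix_null z0 (enum {: 'I_p * 'I_n}) fz0 (enum_uniq _)).
congr (P _); apply/seteqP; split => w /=; have -> : mix z0 (enum {: 'I_p * 'I_n}) w = Z w.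
- by apply/matrixP => i j; rewrite mxE mem_enum.
- by [].
- by apply/matrixP => i j; rewrite mxE mem_enum.
- by [].
Qed.

End poly_null.

(** * Distinctness of the eigenvalues *)

(* The Hankel matrix of the power sums tr(W^(i+j+1)), W = Y Y^T, factors through the
   Vandermonde matrix of the eigenvalues of W, so moment_det Y is a polynomial in Y
   which is nonzero exactly when these eigenvalues are distinct and nonzero. *)
Definition moment_det (K : comNzRingType) (p m : nat) (Y : 'M[K]_(p, m)) : K :=
  \det (\matrix_(i < p, j < p) \tr ((Y *m Y^T) ^+ (i + j).+1)).

Lemma map_mxX (K K' : comNzRingType) (h : {rmorphism K -> K'}) (p k : nat)
  (A : 'M[K]_p) : map_mx h (A ^+ k) = map_mx h A ^+ k.
Proof.
elim: k => [|k IH]; first by rewrite !expr0 map_mx1.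
by rewrite !exprS [LHS]map_mxM IH.
Qed.

Lemma moment_det_map (K K' : comNzRingType) (h : {rmorphism K -> K'}) (p m : nat)
  (Y : 'M[K]_(p, m)) : moment_det (map_mx h Y) = h (moment_det Y).
Proof.
rewrite /moment_det -det_map_mx; congr (\det _); apply/matrixP => i j.
by rewrite !mxE matrix.map_trmx -map_mxM -map_mxX trace_map_mx.
Qed.

Lemma spectral_exp (R : realType) (p k : nat) (H : 'M[R]_p) (l : 'rV[R]_p) :
  H^T *m H = 1%:M ->
  (H *m diag_mx l *m H^T) ^+ k = H *m diag_mx (\row_i l 0 i ^+ k) *m H^T.
Proof.
move=> HTH; elim: k => [|k IH].
  rewrite expr0 [X in diag_mx X](_ : _ = const_mx 1).
    by rewrite diag_const_mx mulmx1 (mulmx1C HTH).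
  by apply/rowP => i; rewrite !mxE expr0.
rewrite exprS IH [LHS](_ : _ = H *m diag_mx l *m H^T *m
  (H *m diag_mx (\row_i l 0 i ^+ k) *m H^T))//.
rewrite !mulmxA -(mulmxA (H *m diag_mx l) H^T H) HTH mulmx1 -(mulmxA H) mulmx_diag.
by congr (_ *m diag_mx _ *m _); apply/rowP => i; rewrite !mxE exprS.
Qed.

(** The shift by one in the exponent i + j + 1 supplies a middle factor diag(l), hence the product
    that detects a zero eigenvalue. *)
Lemma moment_det_spectral (R : realType) (p m : nat) (Y : 'M[R]_(p, m))
    (H : 'M[R]_p) (l : 'rV[R]_p) :
  H^T *m H = 1%:M -> Y *m Y^T = H *m diag_mx l *m H^T ->
  moment_det Y = \det (Vandermonde p l) ^+ 2 * \prod_i l 0 i.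
Proof.
move=> HTH YE; rewrite /moment_det YE.
rewrite [X in \det X](_ : _ = Vandermonde p l *m diag_mx l *m (Vandermonde p l)^T).
  by rewrite !det_mulmx det_tr det_diag expr2; ring.
apply/matrixP => i j; rewrite [LHS]mxE (spectral_exp _ _ HTH).
rewrite mxtrace_mulC mulmxA HTH mul1mx mxtrace_diag mul_mx_diag mxE; apply: eq_bigr => k _.
by rewrite !mxE -addSn exprD exprSr.
Qed.

Lemma moment_det_neq0_distinct (R : realType) (p m : nat) (Y : 'M[R]_(p, m))
    (H : 'M[R]_p) (l : 'rV[R]_p) :
  spectral_dec (Y *m Y^T) H l -> moment_det Y != 0 ->
  (forall i, 0 < l 0 i) /\ (forall i j : 'I_p, (i < j)%N -> l 0 j < l 0 i).
Proof.
move=> [HTH YE ls]; rewrite (moment_det_spectral HTH YE).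
rewrite mulf_eq0 expf_eq0/= negb_or => /andP[V0 /prodf_neq0 l0].
have l_inj (i j : 'I_p) : i != j -> l 0 i != l 0 j.
  move=> ij; apply: contraNneq V0 => lij.
  rewrite -det_tr; apply/eqP/(determinant_alternate ij) => k.
  by rewrite !mxE lij.
split=> [i|i j ij]; last first.
  rewrite lt_neqAle ls ?(ltnW ij)// andbT l_inj//.
  by rewrite -val_eqE/= gtn_eqF.
rewrite lt_neqAle eq_sym l0//=.
have -> : l 0 i = \sum_k ((H^T *m Y) i k) ^+ 2.
  have : (H^T *m Y *m (H^T *m Y)^T) i i = l 0 i.
    rewrite trmx_mul trmxK mulmxA -(mulmxA _ Y) YE !mulmxA HTH mul1mx.
    by rewrite -mulmxA HTH mulmx1 !mxE eqxx mulr1n.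
  by move=> <-; rewrite mxE; apply: eq_bigr => k _; rewrite [_^T _ _]mxE expr2.
by apply: sumr_ge0 => k _; exact: sqr_ge0.
Qed.

(** The rectangular diagonal matrix with entries 1, ..., p, which fits because p <= m, has Gram
    matrix diag(1, 4, ..., p^2). *)
Lemma moment_det_neq0_ex (R : realType) (p m : nat) : (p <= m)%N ->
  exists Y : 'M[R]_(p, m), moment_det Y != 0.
Proof.
move=> pm; pose Y : 'M[R]_(p, m) := \matrix_(i, j) ((i == j :> nat)%:R * i.+1%:R).
exists Y; pose l : 'rV[R]_p := \row_i (i.+1%:R ^+ 2).
rewrite (@moment_det_spectral _ _ _ Y 1%:M l) ?trmx1 ?mulmx1 ?mul1mx//; last first.
  apply/matrixP => i j; rewrite !mxE (bigD1 (widen_ord pm i))//= big1 => [|k ki].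
    rewrite !mxE/= eqxx mul1r addr0 [j == i :> nat]eq_sym val_eqE.
    have [->|_] := eqVneq i j; first by rewrite mul1r mulr1n expr2.
    by rewrite mul0r mulr0 mulr0n.
  rewrite !mxE; have -> : (i == k :> nat) = false.
    by apply: contraNF ki => /eqP ik; apply/eqP/val_inj.
  by rewrite !mul0r.
rewrite mulf_neq0// ?expf_neq0//; last first.
  by apply/prodf_neq0 => i _; rewrite mxE expf_neq0// pnatr_eq0.
rewrite det_Vandermonde; apply/prodf_neq0 => i _; apply/prodf_neq0 => j ij.
rewrite !mxE subr_eq0 eqrXn2 ?ler0n// eqr_nat eqSS.
by rewrite gtn_eqF.
Qed.

(** The same determinant formed over [{poly R}], with the indeterminate at entry e, evaluates to the
    real one because [moment_det] commutes with ring morphisms. *)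
Lemma moment_det_poly (R : realType) (p n m : nat) (C : 'M[R]_(p, m))
    (O : 'M[R]_(n, m)) (x : 'M[R]_(p, n)) (e : 'I_p * 'I_n) :
  exists q : {poly R}, forall t, moment_det
     (C + (\matrix_(i, j) if (i, j) == e then t else x i j) *m O) = q.[t].
Proof.
pose X : 'M[{poly R}]_(p, n) := \matrix_(i, j) if (i, j) == e then 'X else (x i j)%:P.
exists (moment_det (map_mx polyC C + X *m map_mx polyC O)) => t.
rewrite -/(horner_eval t _) -moment_det_map; congr moment_det.
have evalC k k' (A : 'M[R]_(k, k')) : map_mx (horner_eval t) (map_mx polyC A) = A.
  by apply/matrixP => i j; rewrite !mxE/= /horner_eval hornerC.
rewrite map_mxD map_mxM !evalC; congr (_ + _); congr (_ *m _).
apply/matrixP => i j; rewrite !mxE /horner_eval.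
by case: ifP => _; rewrite /= /horner_eval ?hornerX ?hornerC.
Qed.

Section measurable_moment_det.
Context d (T : measurableType d) (R : realType).

Lemma measurable_mulmx (p n m : nat) (A : T -> 'M[R]_(p, n)) (B : T -> 'M[R]_(n, m)) :
  (forall i j, measurable_fun setT (fun w => A w i j)) ->
  (forall i j, measurable_fun setT (fun w => B w i j)) ->
  forall i j, measurable_fun setT (fun w => (A w *m B w) i j).
Proof.
move=> mA mB i j; under eq_fun do rewrite mxE.
by apply: measurable_sum => k; exact: measurable_funM.
Qed.

Lemma measurable_moment_det (p m : nat) (Y : T -> 'M[R]_(p, m)) :
  (forall i j, measurable_fun setT (fun w => Y w i j)) ->
  measurable_fun setT (fun w => moment_det (Y w)).
Proof.
move=> mY.
have mW k : forall i j, measurable_fun setT (fun w => ((Y w *m (Y w)^T) ^+ k) i j).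
  elim: k => [|k IH] i j; first by under eq_fun do rewrite expr0; exact: measurable_cst.
  under eq_fun do rewrite exprS.
  apply: measurable_mulmx => // a b; apply: measurable_mulmx => // a' b'.
  by under eq_fun do rewrite mxE; exact: mY.
(* The determinant unfolds to its Leibniz sum over permutations s. *)
apply: measurable_sum => s; apply: measurable_funM; first exact: measurable_cst.
apply: measurable_prod => i _; under eq_fun do rewrite mxE.
exact: measurable_sum.
Qed.

End measurable_moment_det.

(** * Second moment of a normal variable *)

(** The Radon-Nikodym derivative of the normal law and [normal_pdf] have the same integral over
    every measurable set, so they agree almost everywhere. *)
Lemma ge0_integral_normal_prob (R : realType) (m s : R)
    (f : measurableTypeR R -> \bar R) :
  measurable_fun setT f -> (forall x, 0 <= f x)%E ->
  (\int[normal_prob m s]_x f x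
   = \int[lebesgue_measure]_x (f x * (normal_pdf m s x)%:E))%E.
Proof.
move=> mf f0.
have dom := normal_prob_dominates m s.
rewrite -(Radon_Nikodym_SigmaFinite.change_of_variables dom)//.
have mpdf : measurable_fun setT (fun x : measurableTypeR R => (normal_pdf m s x)%:E).
  by apply/measurable_EFinP; exact: measurable_normal_pdf.
have iRN := Radon_Nikodym_SigmaFinite.f_integrable dom.
apply: ae_eq_integral => //.
- apply: emeasurable_funM => //; apply: (measurable_int lebesgue_measure); exact: iRN.
- exact: (emeasurable_funM mf mpdf).
apply: ae_eqe_mul2l; apply: integral_ae_eq => //.
by move=> E ET mE; rewrite -Radon_Nikodym_SigmaFinite.f_integral.
Qed.

Lemma normal_sqr_lt_pinfty (R : realType) :
  (\int[normal_prob (0:R) 1]_x (x ^+ 2)%:E < +oo)%E.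
Proof.
have s0 : Num.sqrt (2:R) != 0 by rewrite gt_eqF// sqrtr_gt0.
(* With y = x^2 / 4, x^2 exp(-x^2/2) = 4 y exp(-2y) <= 4 exp(-y), since exp(y) >= 1 + y; and exp(-y)
   is the unnormalised density of variance 2. The peaks convert the normalisations. *)
pose c : R := 4 * normal_peak 1 / normal_peak (Num.sqrt 2).
rewrite ge0_integral_normal_prob//; last 2 first.
- by apply/measurable_EFinP; exact: measurable_funX.
- by move=> x; rewrite lee_fin sqr_ge0.
apply: (@le_lt_trans _ _
  (\int[lebesgue_measure]_x (c%:E * (normal_pdf 0 (Num.sqrt (2:R)) x)%:E))%E).
  apply: ge0_le_integral => //.
  - by move=> x _; rewrite mule_ge0// lee_fin ?sqr_ge0 ?normal_pdf_ge0.
  - apply: emeasurable_funM; apply/measurable_EFinP; first exact: measurable_funX.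
    exact: measurable_normal_pdf.
  - apply: emeasurable_funM => //; apply/measurable_EFinP.
    exact: measurable_normal_pdf.
  move=> x _; rewrite -EFinM lee_fin !normal_pdfE ?oner_neq0//.
  rewrite /normal_fun subr0 expr1n sqr_sqrtr//.
  rewrite /c -[leRHS]mulrA mulKf; last by rewrite gt_eqF// normal_peak_gt0.
  rewrite -[leRHS]mulrA.
  rewrite [leLHS]mulrCA [leRHS]mulrCA ler_wpM2l ?normal_peak_ge0//.
  have := expR_ge1Dx (x ^+ 2 / (2 *+ 2)).
  have -> : - x ^+ 2 / (1 *+ 2) = - x ^+ 2 / (2 *+ 2) - x ^+ 2 / (2 *+ 2).
    by field.
  rewrite expRD [expR (- (_ / _))]expRN mulrA => h.
  rewrite ler_pdivrMr ?expR_gt0//.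
  have := expR_gt0 (- x ^+ 2 / (2 *+ 2)).
  move: (expR _) h => e h; move: (expR _) => e' e'0.
  have -> : x ^+ 2 = 4 * (x ^+ 2 / (2 *+ 2)) by field.
  by move: (x ^+ 2 / (2 *+ 2)) h => y h; nra.
rewrite integralZl//; last exact: integrable_normal_pdf.
by rewrite integral_normal_pdf mule1 ltry.
Qed.

Section normal_rv.
Context d (T : measurableType d) (R : realType) (P : probability T R).
Variable U : T -> R.
Hypothesis mU : measurable_fun setT U.
Hypothesis U_normal : forall B : set R, measurable B ->
  P (U @^-1` B) = normal_prob 0 1 B.

Lemma normal_rv_sqr_integrable : P.-integrable setT (fun w => (U w ^+ 2)%:E).
Proof.
have mX2 : measurable_fun setT (fun x : measurableTypeR R => (x ^+ 2)%:E).
  by apply/measurable_EFinP; exact: measurable_funX.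
apply/integrableP; split.
  by apply/measurable_EFinP; exact: measurable_funX.
under eq_integral do rewrite gee0_abs ?lee_fin ?sqr_ge0//.
have mU' : measurable_fun setT (U : T -> measurableTypeR R) by exact: mU.
pose X : {mfun T >-> measurableTypeR R} :=
  HB.pack (U : T -> measurableTypeR R) (isMeasurableFun.Build _ _ _ _ _ mU').
have := @ge0_integral_distribution _ _ _ _ _ P X _ mX2.
move=> <- => [|y]; last by rewrite lee_fin sqr_ge0.
apply: le_lt_trans (normal_sqr_lt_pinfty R); rewrite le_eqVlt; apply/orP; left.
apply/eqP; apply: eq_measure_integral => A mA _.
by rewrite /= /distribution /pushforward U_normal.
Qed.

End normal_rv.

(** * Loss and risk *)

Lemma posdef_unitmx (R : realType) (p : nat) (A : 'M[R]_p) : posdef A -> A \in unitmx.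
Proof.
move=> [_ Apos]; rewrite unitmxE unitfE; apply/negP => /det0P[v v0 vA].
have := Apos v^T; rewrite trmx_eq0 => /(_ v0).
by rewrite trmxK vA mul0mx mxE ltxx.
Qed.

Lemma mxtrace_trmx_mul (R : realType) (p q : nat) (A B : 'M[R]_(p, q)) :
  \tr (A^T *m B) = \sum_a \sum_b A a b * B a b.
Proof.
rewrite exchange_big; apply: eq_bigr => b _; rewrite mxE.
by apply: eq_bigr => a _; rewrite mxE.
Qed.

Lemma shrink_sqr_norm (R : realType) (p m : nat) (Y : 'M[R]_(p, m)) (H : 'M[R]_p)
    (g : 'I_p -> 'rV[R]_p -> R) (l : 'rV[R]_p) (F := H *m Gmat g l *m H^T *m Y) :
  H^T *m H = 1%:M -> Y *m Y^T = H *m diag_mx l *m H^T ->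
  \tr (F *m F^T) = \sum_i l 0 i * g i l ^+ 2.
Proof.
move=> HTH YE; rewrite /F trmx_mul !mulmxA -(mulmxA _ Y) YE.
rewrite !trmx_mul trmxK /Gmat tr_diag_mx !mulmxA.
rewrite -(mulmxA _ H^T H) HTH mulmx1 -(mulmxA _ H^T H) HTH mulmx1.
rewrite mxtrace_mulC !mulmxA HTH mul1mx !mulmx_diag mxtrace_diag.
by apply: eq_bigr => i _; rewrite !mxE; ring.
Qed.

Section loss_decomposition.
Variables (R : realType) (p n : nat) (Sigma S12 : 'M[R]_p) (Theta Z : 'M[R]_(p, n)).
Variable O1 : 'M[R]_(n, n.-1).
Hypothesis S12_pos : posdef S12.
Hypothesis S12_sqr : S12 *m S12 = Sigma.
Hypothesis O1TO1 : O1^T *m O1 = 1%:M.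
Hypothesis O1O1T : O1 *m O1^T = 1%:M - const_mx (n%:R^-1).

Let X := Theta + S12 *m Z.
Let Y := invmx S12 *m X *m O1.

Let S12u : S12 \in unitmx. Proof. exact: posdef_unitmx. Qed.
Let S12T : S12^T = S12. Proof. by case: S12_pos. Qed.

Let centerE : invmx S12 *m centerX X = Y *m O1^T.
Proof.
rewrite /centerX /Y -[X in _ *m (X - _)]mulmx1 -mulmxBr -O1O1T.
by rewrite !mulmxA.
Qed.

(** Centring is right multiplication by O_1 O_1^T, so the whitened centred data are Y O_1^T, and
    O_1^T O_1 = 1 removes O_1 from the Gram matrix. *)
Lemma centered_gram :
  invmx S12 *m centerX X *m (centerX X)^T *m invmx S12 = Y *m Y^T.
Proof.
have XT : (centerX X)^T *m invmx S12 = (invmx S12 *m centerX X)^T.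
  by rewrite trmx_mul trmx_inv S12T.
rewrite -mulmxA XT centerE trmx_mul trmxK mulmxA -(mulmxA Y) O1TO1.
by rewrite mulmx1.
Qed.

Let sandwich (D : 'M[R]_(p, n)) :
  (S12 *m D)^T *m invmx Sigma *m (S12 *m D) = D^T *m D.
Proof.
have SS : invmx Sigma *m S12 = invmx S12.
  rewrite -[LHS](mulmxK S12u) -(mulmxA _ S12 S12) S12_sqr mulVmx ?mul1mx//.
  by rewrite -S12_sqr unitmx_mul S12u.
rewrite trmx_mul S12T -!mulmxA (mulmxA (invmx Sigma)) SS.
by rewrite mulKVmx.
Qed.

Lemma loss_identity : (n * p)%:R != 0 :> R ->
  (n * p)%:R * loss Sigma Theta X = \sum_a \sum_b Z a b ^+ 2.
Proof.
move=> np0; rewrite /loss mulVKf// /X addrC addKr sandwich mxtrace_trmx_mul.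
by apply: eq_bigr => a _; apply: eq_bigr => b _; rewrite expr2.
Qed.

(** After whitening the error is Z - F O_1^T. In the cross term O_1 moves across the trace onto Z,
    and Z O_1 is Y minus its mean; in the square of F O_1^T it cancels. *)
Lemma loss_shrink (H : 'M[R]_p) (g : 'I_p -> 'rV[R]_p -> R) (l : 'rV[R]_p) :
  (n * p)%:R != 0 :> R -> spectral_dec (Y *m Y^T) H l ->
  (n * p)%:R * loss Sigma Theta (shrink_est S12 H g l X)
  = \sum_a \sum_b Z a b ^+ 2
    - 2 * \sum_a \sum_b (Y - invmx S12 *m Theta *m O1) a b
          * (H *m Gmat g l *m H^T *m Y) a b
    + \sum_i l 0 i * g i l ^+ 2.
Proof.
move=> np0 [HTH YE _]; rewrite /loss mulVKf//.
pose F := H *m Gmat g l *m H^T *m Y.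
have -> : shrink_est S12 H g l X - Theta = S12 *m (Z - F *m O1^T).
  rewrite /shrink_est -(mulmxA _ (invmx S12)) centerE mulmxBr /F !mulmxA.
  by rewrite addrAC /X (addrC Theta) addrK.
rewrite sandwich [(Z - _)^T]linearB/= mulmxBl !mulmxBr !linearB/=.
have -> : \tr ((F *m O1^T)^T *m Z) = \tr (Z^T *m (F *m O1^T)).
  by rewrite -mxtrace_tr trmx_mul trmxK.
have -> : \tr (Z^T *m (F *m O1^T)) =
    \sum_a \sum_b (Y - invmx S12 *m Theta *m O1) a b * F a b.
  have -> : Y - invmx S12 *m Theta *m O1 = Z *m O1.
    by rewrite /Y /X mulmxDr mulmxDl addrC addKr mulKmx.
  by rewrite mulmxA mxtrace_mulC mulmxA -trmx_mul mxtrace_trmx_mul.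
have -> : \tr ((F *m O1^T)^T *m (F *m O1^T)) = \sum_i l 0 i * g i l ^+ 2.
  rewrite mxtrace_mulC trmx_mul trmxK mulmxA -(mulmxA F) O1TO1 mulmx1.
  exact: shrink_sqr_norm.
have -> : \tr (Z^T *m Z) = \sum_a \sum_b Z a b ^+ 2.
  rewrite mxtrace_trmx_mul.
  by apply: eq_bigr => a _; apply: eq_bigr => b _; rewrite expr2.
ring.
Qed.

End loss_decomposition.

Section real_expectation.
Context d (T : measurableType d) (R : realType) (P : probability T R).
Implicit Types f g : T -> R.
Local Notation intble f := (P.-integrable setT (fun w => (f w)%:E)).
Local Notation I f := (\int[P]_w (f w)%:E)%E.

Lemma integrable_addr f g : intble f -> intble g -> intble (fun w => f w + g w).
Proof. by move=> hf hg; under eq_fun do rewrite EFinD; exact: integrableD. Qed.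

Lemma integrable_subr f g : intble f -> intble g -> intble (fun w => f w - g w).
Proof. by move=> hf hg; under eq_fun do rewrite EFinB; exact: integrableB. Qed.

Lemma integral_subr f g : intble f -> intble g ->
  I (fun w => f w - g w) = (I f - I g)%E.
Proof. by move=> hf hg; under eq_integral do rewrite EFinB; exact: integralB. Qed.

Lemma integrable_mulrl c f : intble f -> intble (fun w => c * f w).
Proof. by move=> hf; under eq_fun do rewrite EFinM; exact: integrableZl. Qed.

Lemma integral_addr f g : intble f -> intble g ->
  I (fun w => f w + g w) = (I f + I g)%E.
Proof. by move=> hf hg; under eq_integral do rewrite EFinD; exact: integralD. Qed.

Lemma integral_mulrl c f : intble f -> I (fun w => c * f w) = (c%:E * I f)%E.
Proof. by move=> hf; under eq_integral do rewrite EFinM; exact: integralZl. Qed.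

Lemma integrable_sumr (K : Type) (s : seq K) (f : K -> T -> R) :
  (forall k, intble (f k)) -> intble (fun w => \sum_(k <- s) f k w).
Proof.
move=> hf; elim: s => [|k s IH].
  by under eq_fun do rewrite big_nil; exact: integrable0.
by under eq_fun do rewrite big_cons; exact: integrable_addr.
Qed.

Lemma integral_sumr0 (K : Type) (s : seq K) (f : K -> T -> R) :
  (forall k, intble (f k)) -> (forall k, I (f k) = 0%E) ->
  I (fun w => \sum_(k <- s) f k w) = 0%E.
Proof.
move=> hf f0; elim: s => [|k s IH].
  by under eq_integral do rewrite big_nil; exact: integral0.
under eq_integral do rewrite big_cons.
rewrite integral_addr ?f0 ?IH ?adde0//; exact: integrable_sumr.
Qed.

End real_expectation.

Unset Implicit Arguments.
Set Strict Implicit.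
Set Printing Implicit Defensive.

Theorem theoremA1 (R : realType) (p n : nat) (hpn : (p <= n - 1)%N) (hn : (0 < n)%N)
  (d : measure_display) (T : measurableType d) (P : probability T R)
  (Sigma S12 : 'M[R]_p) (Theta : 'M[R]_(p, n))
  (Z : T -> 'M[R]_(p, n))
  (O1 : 'M[R]_(n, n.-1))
  (eigvec : 'M[R]_p -> 'M[R]_p) (eigval : 'M[R]_p -> 'rV[R]_p)
  (g : 'I_p -> 'rV[R]_p -> R) :
  (* Sigma known positive definite; S12 = Sigma^{1/2} its symmetric p.d. root *)
  posdef Sigma -> posdef S12 -> S12 *m S12 = Sigma ->
  (* Z has i.i.d. N(0,1) entries, so X = Theta + Sigma^{1/2} Z has independent
     columns x_i ~ N_p(theta_i, Sigma) *)
  (forall i j, measurable_fun setT (fun w => Z w i j)) ->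
  (forall i j (B : set R), measurable B ->
     P ((fun w => Z w i j) @^-1` B) = normal_prob 0 1 B) ->
  (forall B : 'I_p -> 'I_n -> set R, (forall i j, measurable (B i j)) ->
     P (\big[setI/setT]_(i < p) \big[setI/setT]_(j < n)
          ((fun w => Z w i j) @^-1` B i j))
     = (\prod_(i < p) \prod_(j < n) P ((fun w => Z w i j) @^-1` B i j))%E) ->
  (* O1 : O1^T O1 = I_{n-1}, O1 O1^T = I_n - n^-1 1 1^T *)
  O1^T *m O1 = 1%:M -> O1 *m O1^T = 1%:M - const_mx (n%:R^-1) ->
  (* spectral decomposition W = H diag(l) H^T, l decreasing *)
  (forall W : 'M[R]_p, mxsym W -> spectral_dec W (eigvec W) (eigval W)) ->
  (* the g_i are differentiable on {l_1 > ... > l_p > 0} *)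
  (forall l : 'rV[R]_p, (forall i, 0 < l 0 i) ->
     (forall i j : 'I_p, (i < j)%N -> l 0 j < l 0 i) ->
     forall i, differentiable (g i) l) ->
  let X := fun w => Theta + S12 *m Z w in
  let W := fun w => invmx S12 *m centerX (X w) *m (centerX (X w))^T *m invmx S12 in
  let Y := fun w => invmx S12 *m X w *m O1 in
  let MY := invmx S12 *m Theta *m O1 in
  let F := shrinkY eigvec eigval g in
  (* Stein's identity applies to the entries of H G H^T Y *)
  (forall a b,
     P.-integrable setT (fun w => ((Y w a b - MY a b) * F (Y w) a b)%R%:E) /\
     P.-integrable setT (fun w => ('D_(delta_mx a b) (fun V => F V a b) (Y w))%R%:E) /\
     ('E_P[fun w => ((Y w a b - MY a b) * F (Y w) a b)%R]
      = 'E_P[fun w => ('D_(delta_mx a b) (fun V => F V a b) (Y w))%R])%E) ->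
  (* the expectations involved are finite *)
  P.-integrable setT
    (fun w => (loss Sigma Theta
                 (shrink_est S12 (eigvec (W w)) g (eigval (W w)) (X w)))%R%:E) ->
  P.-integrable setT (fun w => (DeltaG n g (eigval (W w)))%R%:E) ->
  ('E_P[fun w => (DeltaG n g (eigval (W w)))%R]
   = ((n * p)%:R)%:E *
     ('E_P[fun w => (loss Sigma Theta
                      (shrink_est S12 (eigvec (W w)) g (eigval (W w)) (X w)))%R]
      - 'E_P[fun w => (loss Sigma Theta (X w))%R]))%E.
Proof.
move=> Spos S12pos S12E mZ Zn Zi O1TO1 O1O1T spec dg X W Y MY F stein iL iD.
(* For p = 0 the factor 1/(np) in the loss cannot be cancelled, but both sides are 0. *)
have [p0|p0] := eqVneq p 0%N.
  subst p; rewrite muln0 mul0e expectation.unlock.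
  under eq_integral do rewrite /DeltaG big_ord0.
  exact: integral0.
have np0 : (n * p)%:R != 0 :> R by rewrite pnatr_eq0 muln_eq0 negb_or p0 -lt0n hn.
have WE w : W w = Y w *m (Y w)^T.
  exact: centered_gram.
have S12u := posdef_unitmx S12pos.
have YE w : Y w = MY + Z w *m O1.
  by rewrite /Y /MY /X mulmxDr mulmxDl mulKmx.
have gram_sym w : mxsym (Y w *m (Y w)^T) by rewrite /mxsym trmx_mul trmxK.
pose q a b w := (Y w a b - MY a b) * F (Y w) a b.
pose dF a b w := 'D_(delta_mx a b) (fun V => F V a b) (Y w).
pose L w := loss Sigma Theta (shrink_est S12 (eigvec (W w)) g (eigval (W w)) (X w)).
pose LX w := loss Sigma Theta (X w).
pose Dl w := DeltaG n g (eigval (W w)).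
have iq a b : P.-integrable setT (fun w => (q a b w)%:E) by have [] := stein a b.
have idF a b : P.-integrable setT (fun w => (dF a b w)%:E) by have [_ []] := stein a b.
have Eq a b : (\int[P]_w (q a b w)%:E = \int[P]_w (dF a b w)%:E)%E.
  by have [_ [_]] := stein a b; rewrite expectation.unlock.
(* Finiteness of the risk of X comes from the second moments of Z. *)
have iLX : P.-integrable setT (fun w => (LX w)%:E).
  have -> : (fun w => (LX w)%:E) =
      (fun w => (((n * p)%:R)^-1 * \sum_a \sum_b Z w a b ^+ 2)%:E).
    apply/funext => w; rewrite -(loss_identity Theta (Z w) S12pos S12E np0).
    by rewrite mulKf.
  apply: integrable_mulrl; apply: integrable_sumr => a; apply: integrable_sumr => b.
  by apply: normal_rv_sqr_integrable => // B; exact: Zn.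
pose N := [set w | moment_det (Y w) = 0].
have mYd : measurable_fun setT (fun w => moment_det (Y w)).
  apply: measurable_moment_det => i j; under eq_fun do rewrite YE mxE.
  apply: measurable_funD => //.
  by apply: measurable_mulmx => // a b; exact: measurable_cst.
have mN : measurable N.
  have := mYd measurableT [set 0] (measurable_set1 0).
  by rewrite setTI.
have PN : P N = 0%E.
  have -> : N = [set w | moment_det (MY + Z w *m O1) = 0].
    by apply/seteqP; split => w; rewrite /N/= YE.
  apply: (@normal_matrix_null _ _ _ P p n Z mZ Zn Zi
    (fun z => moment_det (MY + z *m O1))).
  - move=> d' T' M mM; apply: measurable_moment_det => i j.
    under eq_fun do rewrite mxE.
    apply: measurable_funD => //.
    by apply: measurable_mulmx => // a b; exact: measurable_cst.
  - by move=> x c; exact: moment_det_poly.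
  have [Y0 Y0d] : exists Y0 : 'M[R]_(p, n.-1), moment_det Y0 != 0.
    by apply: moment_det_neq0_ex; rewrite -subn1.
  (* Since O_1^T O_1 = 1, this choice of Z makes Y equal to Y0. *)
  exists ((Y0 - MY) *m O1^T).
  by rewrite -mulmxA O1TO1 mulmx1 addrC subrK.
pose S w := \sum_a \sum_b (q a b w - dF a b w).
(* [S] is the pointwise gap between the two sides of Stein's identity. The Stein products cancel
   between the loss and [S], leaving sum_i l_i g_i^2 - 2 div F. *)
have key w : ~ N w -> Dl w = (n * p)%:R * (L w - LX w) + 2 * S w.
  move=> /eqP Yd.
  have sp := spec _ (gram_sym w).
  have [l0 ls] := moment_det_neq0_distinct sp Yd.
  set l := eigval (Y w *m (Y w)^T) in l0 ls sp.
  have l_inj i j : i != j -> l 0 i != l 0 j.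
    rewrite -val_eqE neq_ltn => /orP[/ls ji|/ls ij]; first by rewrite gt_eqF.
    by rewrite lt_eqF.
  have dgl i : differentiable (g i) l by exact: dg.
  have := shrinkY_divergence spec l_inj dgl.
  rewrite mulrBr /L /LX !WE (loss_identity Theta (Z w) S12pos S12E np0).
  rewrite (loss_shrink S12pos S12E O1TO1 O1O1T g np0 sp) -/l.
  rewrite /S /Dl WE -/l => dv.
  have -> : \sum_a \sum_b (q a b w - dF a b w) =
      \sum_a \sum_b q a b w - \sum_a \sum_b dF a b w.
    by rewrite -sumrB; apply: eq_bigr => a _; rewrite -sumrB.
  rewrite (dv : \sum_a \sum_b dF a b w = _) /DeltaG.
  have -> : \sum_a \sum_b q a b w = \sum_a \sum_b
     (invmx S12 *m (Theta + S12 *m Z w) *m O1 - invmx S12 *m Theta *m O1) a b *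
     (eigvec (Y w *m (Y w)^T) *m Gmat g l *m (eigvec (Y w *m (Y w)^T))^T *m Y w) a b.
    apply: eq_bigr => a _; apply: eq_bigr => b _; rewrite /q; congr (_ * _).
    by rewrite [RHS]mxE [X in _ = _ + X]mxE.
  have -> : (n - 1)%:R = n.-1%:R :> R by rewrite subn1.
  move: (\sum_a \sum_b Z w a b ^+ 2) => A.
  set x := \sum_a \sum_b _ * _.
  set dv' := \sum_i (_ + _ + _).
  transitivity (\sum_i l 0 i * g i l ^+ 2 - 2 * dv'); last by ring.
  rewrite /dv' mulr_sumr -sumrB; apply: eq_bigr => i _.
  by field; rewrite gt_eqF.
have iLLX : P.-integrable setT (fun w => (L w - LX w)%:E) by exact: integrable_subr.
have iqd a b : P.-integrable setT (fun w => (q a b w - dF a b w)%:E).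
  exact: integrable_subr.
have iS' a : P.-integrable setT (fun w => (\sum_b (q a b w - dF a b w))%:E).
  exact: integrable_sumr.
have iS : P.-integrable setT (fun w => (S w)%:E) by exact: integrable_sumr.
have S0 : (\int[P]_w (S w)%:E = 0)%E.
  apply: integral_sumr0 => // a; apply: integral_sumr0 => // b.
  rewrite integral_subr// Eq subee//; exact: integrable_fin_num.
have irhs : P.-integrable setT
    (fun w => ((n * p)%:R * (L w - LX w) + 2 * S w)%:E).
  by apply: integrable_addr; exact: integrable_mulrl.
rewrite expectation.unlock.
transitivity (\int[P]_w ((n * p)%:R * (L w - LX w) + 2 * S w)%:E)%E.
  apply: ae_eq_integral => //; [exact: measurable_int iD|exact: measurable_int irhs|].
  exists N; split => // w /= h; apply: contrapT => /key Dw; apply: h => _.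
  by rewrite -Dw.
rewrite integral_addr; [|exact: integrable_mulrl|exact: integrable_mulrl].
by rewrite (integral_mulrl _ iLLX) (integral_mulrl _ iS) integral_subr// S0 mule0 adde0.
Qed.
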